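(* Let $G$ be a digraph with at least one dicycle whose underlying graph is a 3-tree. Then $\nu(G) = g(G)$.
   Context: All graphs and digraphs are finite. A graph is a pair $(V,E)$ with $E$ a set of unordered pairs of distinct vertices. A digraph is a pair $(V,E)$ with $E$ a set of ordered pairs of distinct vertices, called arcs (so there are no loops or parallel arcs, but both $uv$ and $vu$ may be arcs). The underlying graph of a digraph has the same vertex set, and $u,v$ are adjacent in it if and only if at least one of $uv$, $vu$ is an arc. A dicycle is a directed walk in which all vertices are distinct except that the first and last vertices coincide (directed cycle; length at least 2). A feedback arc set of $G$ is a set of arcs that intersects (the arc set of) every dicycle of $G$. A packing is a set of pairwise disjoint feedback arc sets. $\nu(G)$ is the maximum size of a packing in $G$, and $g(G)$ is the length of a shortest dicycle in $G$. A clique is a set of pairwise adjacent vertices. A graph $H$ is a $k$-tree if it has $n \geq k+1$ vertices and there is an ordering $v_1,\ldots,v_n$ of its vertices such that for every $i$, the set $N_{H_i}(v_i)$ of neighbors of $v_i$ in $H_i$ is a clique of size $\min\{k,i-1\}$, where $H_i$ is the subgraph induced by $v_1,\ldots,v_i$. A 3-tree is a $k$-tree with $k=3$. *)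

(* Defs.v *)
From mathcomp Require Import all_boot.

Set Implicit Arguments.
Unset Strict Implicit.
Unset Printing Implicit Defensive.

Record graph (V : finType) := Graph {
  adj : rel V;
  adj_sym : symmetric adj;
  adj_irrefl : irreflexive adj
}.

Record digraph (V : finType) := Digraph {
  arc : rel V;
  arc_irrefl : irreflexive arc
}.

Definition under_adj (V : finType) (G : digraph V) : rel V :=
  fun u v => arc G u v || arc G v u.

Lemma under_adj_sym (V : finType) (G : digraph V) : symmetric (under_adj G).
Proof. by move=> u v; rewrite /under_adj orbC. Qed.

Lemma under_adj_irrefl (V : finType) (G : digraph V) :
  irreflexive (under_adj G).
Proof. by move=> u; rewrite /under_adj arc_irrefl. Qed.

Definition underlying (V : finType) (G : digraph V) : graph V :=
  Graph (under_adj_sym G) (@under_adj_irrefl V G).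

Definition arcs (V : finType) (G : digraph V) : {set V * V} :=
  [set a | arc G a.1 a.2].

(* A dicycle x_0 x_1 ... x_(n-1) x_0 is represented by the sequence
   [:: x_0; ...; x_(n-1)], so its length is the size of the sequence. *)
Definition dicycle (V : finType) (G : digraph V) (c : seq V) : bool :=
  [&& 1 < size c, cycle (arc G) c & uniq c].

Definition dicycle_arcs (V : finType) (c : seq V) : {set V * V} :=
  [set (x, next c x) | x in c].

(* The vertices of a dicycle are distinct, so bounding its length by #|V|
   loses nothing: see feedback_arc_setP. *)
Definition feedback_arc_set (V : finType) (G : digraph V)
    (F : {set V * V}) : bool :=
  (F \subset arcs G) &&
  [forall n : 'I_#|V|.+1, forall c : n.-tuple V,
     dicycle G c ==> (F :&: dicycle_arcs c != set0)].

Lemma feedback_arc_setP (V : finType) (G : digraph V) (F : {set V * V}) :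
  reflect (F \subset arcs G /\
           forall c, dicycle G c -> F :&: dicycle_arcs c != set0)
          (feedback_arc_set G F).
Proof.
apply: (iffP andP) => -[FG hF]; split=> //; last first.
  apply/forallP => n; apply/forallP => c; apply/implyP; exact: hF.
move=> c hc; have /and3P[_ _ Uc] := hc.
have le_c : size c < #|V|.+1 by rewrite ltnS -(card_uniqP Uc) max_card.
by move/forallP/(_ (Ordinal le_c))/forallP/(_ (in_tuple c))/implyP/(_ hc): hF.
Qed.

Definition packing (V : finType) (G : digraph V)
    (P : {set {set V * V}}) : bool :=
  [forall F in P, feedback_arc_set G F] && trivIset P.

Definition nu (V : finType) (G : digraph V) : nat :=
  \max_(P : {set {set V * V}} | packing G P) #|P|.

Lemma dicycle_length_ex (V : finType) (G : digraph V) :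
  (exists c, dicycle G c) ->
  exists n, [exists c : n.-tuple V, dicycle G c].
Proof. by case=> c hc; exists (size c); apply/existsP; exists (in_tuple c). Qed.

Definition girth (V : finType) (G : digraph V)
    (hG : exists c, dicycle G c) : nat :=
  ex_minn (dicycle_length_ex hG).

Definition clique (V : finType) (H : graph V) (A : {set V}) : Prop :=
  {in A &, forall x y, x != y -> adj H x y}.

(* The neighbours of v i among the v j with j <= i. *)
Definition back_nbrs (V : finType) (H : graph V) (n : nat) (v : 'I_n -> V)
    (i : 'I_n) : {set V} :=
  [set v j | j : 'I_n & (j <= i) && adj H (v i) (v j)].

(* Positions are numbered from 0, hence minn k i for min {k, i - 1}. *)
Definition is_ktree (k : nat) (V : finType) (H : graph V) : Prop :=
  k.+1 <= #|V| /\
  exists v : 'I_#|V| -> V, bijective v /\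
    forall i, clique H (back_nbrs H v i) /\ #|back_nbrs H v i| = minn k i.

(* Main.v *)
(** Any linear order yields two disjoint feedback arc sets, its forward arcs and
    its backward arcs, which settles the case where [G] has a dicycle of length
    2.  Otherwise a shortest dicycle is a triangle, because a 3-tree is chordal:
    the two neighbours on a dicycle of its last vertex are adjacent.  It then
    suffices to find three linear orders such that every arc is backward in
    exactly one of them.  They are built by inserting the vertices one at a
    time: as every arc between earlier neighbours is forward in one order and
    backward in another, a new vertex with at most three earlier neighbours,
    pairwise adjacent, can be placed suitably in the three orders. *)

From mathcomp Require Import all_boot zify.
Require Import Defs.

Set Implicit Arguments.
Unset Strict Implicit.
Unset Printing Implicit Defensive.

(** * Packings and linear orders *)

Section Packing.
Variables (V : finType) (G : digraph V).

(** Disjoint feedback arc sets meet [c] in different arcs, and [c] has at most [size c] arcs. *)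
Lemma nu_le_dicycle (c : seq V) : dicycle G c -> nu G <= size c.
Proof.
move=> hc; apply/bigmax_leqP => P /andP[/forallP fasP /trivIsetP disjP].
have meetP F : F \in P -> F :&: dicycle_arcs c != set0.
  move=> FP; move: (fasP F); rewrite FP => /feedback_arc_setP[_].
  exact.
have [->|/set0Pn[F0 F0P]] := eqVneq P set0; first by rewrite cards0.
have /set0Pn[e0 _] := meetP _ F0P.
pose f (F : {set V * V}) := odflt e0 [pick e in F :&: dicycle_arcs c].
have fP F : F \in P -> f F \in F :&: dicycle_arcs c.
  move=> /meetP/set0Pn[e eP]; rewrite /f; case: pickP => //= /(_ e).
  by rewrite eP.
have f_inj : {in P &, injective f}.
  move=> F F' FP F'P eqf; apply/eqP/negPn/negP => /(disjP _ _ FP F'P).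
  rewrite disjoint_subset => /subsetP/(_ (f F)).
  have /setIP[fF _] := fP _ FP; have /setIP[fF' _] := fP _ F'P.
  by rewrite eqf inE -{1}eqf fF fF' => /(_ isT).
rewrite -(card_in_imset f_inj).
apply: (@leq_trans #|dicycle_arcs c|).
  by apply/subset_leq_card/subsetP=> _ /imsetP[F /fP/setIP[_ fc] ->].
by apply: leq_trans (leq_imset_card _ _) (card_size _).
Qed.

(** The ranks [r l] need not be injective, so both comparisons are prescribed: this excludes a tie
    between [u] and [v]. *)
Definition backward_once (m : nat) (r : 'I_m -> V -> nat) (u v : V) : Prop :=
  exists k, forall l, (r l u < r l v) = (l != k) /\ (r l v < r l u) = (l == k).

Lemma nu_ge_orders (m : nat) (r : 'I_m -> V -> nat) :
  (exists c, dicycle G c) ->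
  (forall u v, arc G u v -> backward_once r u v) -> m <= nu G.
Proof.
move=> [c0 hc0] hr.
pose F (k : 'I_m) := [set e in arcs G | r k e.2 < r k e.1].
have fasF k : feedback_arc_set G (F k).
  apply/feedback_arc_setP; split.
    by apply/subsetP => e; rewrite inE => /andP[].
  move=> c /and3P[c_gt1 cycc Uc]; apply/negP => /eqP F0.
  have up x : x \in c -> r k x < r k (next c x).
    move=> xc; have axn := next_cycle cycc xc.
    have [k' /(_ k)[-> E]] := hr _ _ axn.
    rewrite -E; apply/negP => down.
    have : (x, next c x) \in F k :&: dicycle_arcs c.
      by rewrite !inE /= axn down; apply: imset_f.
    by rewrite F0 inE.
  case: c c_gt1 {cycc Uc F0} up => // x s _ up.
  (* Ranks cannot increase all along the dicycle: this fails at a vertex of maximal rank. *)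
  have [y yc ymax] := @arg_maxnP V x (mem (x :: s)) (r k) (mem_head x s).
  have nyc : next (x :: s) y \in x :: s by rewrite mem_next.
  by have := ymax _ nyc; rewrite /= leqNgt up.
have disjF k l e : e \in F k -> e \in F l -> k = l.
  case: e => u v; rewrite !inE /= => /andP[auv hk] /andP[_ hl].
  have [j Hj] := hr _ _ auv.
  by move: hk hl; rewrite (Hj k).2 (Hj l).2 => /eqP-> /eqP->.
(* The dicycle [c0] makes every [F k] nonempty, so these disjoint sets are distinct. *)
have F_inj : injective F.
  move=> k l eqF; have /feedback_arc_setP[_ /(_ c0 hc0)] := fasF k.
  case/set0Pn => e /setIP[ek _]; apply: (disjF k l e) => //.
  by rewrite -eqF.
rewrite -[m]card_ord -cardsT -(card_imset _ F_inj).
suff packF : packing G [set F k | k in [set: 'I_m]].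
  exact: (@leq_bigmax_cond _ (packing G) (fun P : {set {set V * V}} => #|P|)).
apply/andP; split.
  by apply/forallP => X; apply/implyP => /imsetP[k _ ->].
apply/trivIsetP => _ _ /imsetP[k _ ->] /imsetP[l _ ->] neqF.
rewrite -setI_eq0; apply/eqP/setP => e; rewrite in_set0 in_setI.
apply/negP => /andP[ek el].
by move: neqF; rewrite (disjF k l e ek el) eqxx.
Qed.

Lemma nu_ge2 : (exists c, dicycle G c) -> 2 <= nu G.
Proof.
move=> hG.
pose q (x : V) : nat := enum_rank x.
have q_lt x : q x < #|V| by apply: ltn_ord.
(* Every [q x] is below [#|V|], so the truncated subtraction does reverse the order. *)
pose r (l : 'I_2) (x : V) : nat := if l == ord0 then q x else #|V| - q x.
apply: (@nu_ge_orders 2 r) => // u v auv.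
have neq : q u != q v.
  by apply: contraTneq auv => /val_inj/enum_rank_inj ->; rewrite arc_irrefl.
move: (q_lt u) (q_lt v); move: #|V| @r => N r ltu ltv.
case: (ltnP (q u) (q v)) => uv.
  by exists ord_max; case=> [[|[|//]] ?]; rewrite /r -!val_eqE /=; lia.
by exists ord0; case=> [[|[|//]] ?]; rewrite /r -!val_eqE /=; lia.
Qed.

End Packing.

(** * Inserting a vertex into three orders *)

Section Insertion.
Variable V : finType.
Implicit Types (r : 'I_3 -> V -> nat) (t : 'I_3 -> nat) (A B : {set V}).

Lemma third_ord (i j : 'I_3) :
  i != j -> exists k, forall l : 'I_3, (l == k) = (l != i) && (l != j).
Proof.
move=> neq_ij; have /cards1P[k /setP hk] : #|~: [set i; j]| == 1.
  by rewrite cardsCs setCK cards2 neq_ij card_ord.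
by exists k => l; move: (hk l); rewrite !inE negb_or => ->.
Qed.

(* A new vertex with in-neighbours [A] and out-neighbours [B] gets the rank [t l]
   in the order [l]; each of its arcs must be backward in exactly one order. *)
Definition insertable r A B : Prop :=
  exists t,
    (forall x, x \in A -> exists k, forall l, (r l x < t l) = (l != k)) /\
    (forall y, y \in B -> exists k, forall l, (r l y < t l) = (l == k)).

Definition thresholds (i j : 'I_3) (a b c : nat) (l : 'I_3) : nat :=
  if l == i then a else if l == j then b else c.

(** The new vertex goes between [A] and [B] in the order [i], first in a second order and last in
    the third. *)
Lemma insertable_separated r A B i :
  (forall x y, x \in A -> y \in B -> r i x < r i y) -> insertable r A B.
Proof.
move=> sep; have [j neq_ij] : exists j, i != j.
  by exists (ordS i); case: i {sep} => [[|[|[|]]]].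
have [k hk] := third_ord neq_ij.
exists (thresholds i j (\max_(x in A) (r i x).+1) 0 (\max_x (r k x).+1)).
have big l x : l == k -> r l x < \max_x (r k x).+1.
  by move/eqP->; apply: (leq_bigmax x).
split=> [x xA|y yB]; [exists j|exists k] => l; rewrite /thresholds.
- have [->|li] := eqVneq l i.
    by rewrite neq_ij; apply: (@leq_bigmax_cond _ [in A] (fun x => (r i x).+1)).
  have [->|lj] := eqVneq l j; first by rewrite ltn0.
  by rewrite big // hk li lj.
- have [->|li] := eqVneq l i.
    rewrite hk eqxx /= ltnNge; apply/negbTE; rewrite negbK.
    by apply/bigmax_leqP => x xA; apply: sep.
  have [->|lj] := eqVneq l j; first by rewrite ltn0 hk eqxx andbF.
  have lk : l == k by rewrite hk li lj.
  by rewrite big ?lk.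
Qed.

(* If no order puts both [a] and [b] before [c], then some order [i] starts with
   [a], another order [j] starts with [b], and the new vertex goes just before
   [c] in both and last in the third order. *)
Lemma insertable21 r a b c :
  (exists i, r i a < r i c) -> (exists i, r i b < r i c) ->
  insertable r [set a; b] [set c].
Proof.
move=> [i ac] [j bc].
have [bci|cbi] := ltnP (r i b) (r i c).
  by apply: (@insertable_separated _ _ _ i) => x y /set2P[]-> /set1P->.
have [acj|caj] := ltnP (r j a) (r j c).
  by apply: (@insertable_separated _ _ _ j) => x y /set2P[]-> /set1P->.
have neq_ij : i != j by apply: contraTneq ac => ->; rewrite -leqNgt.
have [k hk] := third_ord neq_ij.
pose M := (\max_x (r k x).+1).
have big l x : l == k -> r l x < M by move/eqP->; apply: (leq_bigmax x).
exists (thresholds i j (r i c) (r j c) M); split.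
- move=> x /set2P[]->; [exists j|exists i] => l; rewrite /thresholds.
  + have [->|li] := eqVneq l i; first by rewrite ac.
    have [->|lj] := eqVneq l j; first by rewrite ltnNge caj.
    by rewrite big // hk li lj.
  + have [->|li] := eqVneq l i; first by rewrite ltnNge cbi.
    have [->|lj] := eqVneq l j; first by rewrite bc.
    by rewrite big // hk li lj.
- move=> y /set1P->; exists k => l; rewrite /thresholds hk.
  have [->|li] := eqVneq l i; first by rewrite ltnn.
  have [->|lj] := eqVneq l j; first by rewrite ltnn.
  by rewrite big // hk li lj.
Qed.

(** Dually to [insertable21], if no order puts [a] before both [b] and [c], the new vertex goes just
    after [a] in two orders and first in the third. *)
Lemma insertable12 r a b c :
  (exists i, r i a < r i b) -> (exists i, r i a < r i c) ->
  insertable r [set a] [set b; c].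
Proof.
move=> [i ab] [j ac].
have [aci|cai] := ltnP (r i a) (r i c).
  by apply: (@insertable_separated _ _ _ i) => x y /set1P-> /set2P[]->.
have [abj|baj] := ltnP (r j a) (r j b).
  by apply: (@insertable_separated _ _ _ j) => x y /set1P-> /set2P[]->.
have neq_ij : i != j by apply: contraTneq ab => ->; rewrite -leqNgt.
have [k hk] := third_ord neq_ij.
exists (thresholds i j (r i a).+1 (r j a).+1 0); split.
- move=> x /set1P->; exists k => l; rewrite /thresholds hk.
  have [->|li] := eqVneq l i; first by rewrite ltnSn.
  have [->|lj] := eqVneq l j; first by rewrite ltnSn.
  by rewrite ltn0.
- move=> y /set2P[]->; [exists j|exists i] => l; rewrite /thresholds.
  + have [->|li] := eqVneq l i; first by rewrite ltnS leqNgt ab (negbTE neq_ij).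
    have [->|lj] := eqVneq l j; first by rewrite ltnS baj.
    by rewrite ltn0.
  + have [->|li] := eqVneq l i; first by rewrite ltnS cai.
    have [->|lj] := eqVneq l j; first by rewrite ltnS leqNgt ac.
    by rewrite ltn0.
Qed.

Lemma insertable_le3 r A B :
  #|A| + #|B| <= 3 ->
  (forall x y, x \in A -> y \in B -> exists i, r i x < r i y) ->
  insertable r A B.
Proof.
have [->|A0] := eqVneq A set0 => [_ _|].
  by apply: (@insertable_separated _ _ _ ord0) => x y; rewrite inE.
have [->|B0] := eqVneq B set0 => [_ _|].
  by apply: (@insertable_separated _ _ _ ord0) => x y; rewrite inE.
move: A0 B0; rewrite -!card_gt0 => A0 B0 le3 hr.
have [B1|B1] := eqVneq #|B| 1; last first.
  have /eqP/cards1P[a EA] : #|A| = 1 by lia.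
  have /eqP/cards2P[b [c [_ EB]]] : #|B| = 2 by lia.
  by subst A B; apply: insertable12; apply: hr; rewrite !inE eqxx ?orbT.
have /eqP/cards1P[c EB] := B1.
have [A1|A1] := eqVneq #|A| 1.
  have /eqP/cards1P[a EA] := A1; subst A B.
  (* One in-neighbour and one out-neighbour: the case of two in-neighbours with [a] repeated. *)
  rewrite -(setUid [set a]).
  by apply: insertable21; apply: hr; rewrite !inE eqxx.
have /eqP/cards2P[a [b [_ EA]]] : #|A| = 2 by lia.
by subst A B; apply: insertable21; apply: hr; rewrite !inE eqxx ?orbT.
Qed.

(** Ranks from [t l] on move up by one, which frees the rank [t l] for [x] and keeps the order of
    the other vertices. *)
Definition insert_at r t (x : V) (l : 'I_3) (y : V) : nat :=
  if y == x then t l else r l y + (t l <= r l y).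

Lemma insert_at_lt r t x l y z : y != x -> z != x ->
  (insert_at r t x l y < insert_at r t x l z) = (r l y < r l z).
Proof. by rewrite /insert_at => /negbTE-> /negbTE->; lia. Qed.

Lemma insert_at_lt_new r t x l y : y != x ->
  (insert_at r t x l y < insert_at r t x l x) = (r l y < t l).
Proof. by rewrite /insert_at eqxx => /negbTE->; lia. Qed.

Lemma insert_at_gt_new r t x l y : y != x ->
  (insert_at r t x l x < insert_at r t x l y) = ~~ (r l y < t l).
Proof. by rewrite /insert_at eqxx => /negbTE->; lia. Qed.

End Insertion.

(** * Perfect elimination orderings *)

Section PerfectElimination.
Variables (V : finType) (G : digraph V) (pos : V -> nat).
Hypothesis pos_inj : injective pos.

Definition earlier_nbrs (x : V) : {set V} :=
  [set y | (pos y < pos x) && under_adj G x y].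

Hypothesis earlier_clique : forall x, clique (underlying G) (earlier_nbrs x).

(** In a dicycle longer than 3, let [x] be the last vertex for [pos], [y] its successor and [z] its
    predecessor. An arc from [y] to [z] closes a triangle with [x]; an arc from [z] to [y] bypasses
    [x], and induction applies. *)
Lemma short_dicycle (c : seq V) : dicycle G c ->
  exists2 c', dicycle G c' & size c' <= 3.
Proof.
have [n] := ubnP (size c); elim: n c => // n IH c; rewrite ltnS => le_cn hc.
have [|c_gt3] := leqP (size c) 3; first by exists c.
have [x0 x0c] : exists x, x \in c.
  by case: c c_gt3 {hc le_cn} => // x s; exists x; rewrite mem_head.
have [x xc xmax] := @arg_maxnP V x0 (mem c) pos x0c.
have [i s Es] := rot_to xc.
have perm_c y : (y \in x :: s) = (y \in c) by rewrite -Es mem_rot.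
have size_c : size (x :: s) = size c by rewrite -Es size_rot.
have: dicycle G (x :: s) by rewrite -Es /dicycle size_rot rot_cycle rot_uniq.
case: s Es perm_c size_c => [|y s].
  by move=> _ _ sc; rewrite -sc in c_gt3.
case/lastP: s => [|s z]; first by move=> _ _ sc; rewrite -sc in c_gt3.
move=> Es perm_c size_c /and3P[_].
rewrite /= rcons_path last_rcons => /andP[axy /andP[pyz azx]].
move=> /andP[xN /andP[yN Us]].
have neq_yz : y != z.
  by apply: contraNneq yN => ->; rewrite mem_rcons mem_head.
have earlier w : w \in y :: rcons s z -> under_adj G x w ->
    w \in earlier_nbrs x.
  move=> wc axw; rewrite inE axw andbT ltn_neqAle.
  rewrite [_ <= _](xmax w) ?andbT; last by rewrite inE -perm_c inE wc orbT.
  by apply: contraNneq xN => /pos_inj <-.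
have /orP[ayz|azy] : under_adj G y z.
- apply: earlier_clique neq_yz.
    by apply: earlier; rewrite ?mem_head // /under_adj axy.
  by apply: earlier; rewrite ?inE ?mem_rcons ?mem_head ?orbT //= /under_adj azx
    orbT.
- exists [:: x; y; z] => //; rewrite /dicycle /= axy ayz azx /= !inE neq_yz.
  by move: xN; rewrite !inE mem_rcons inE !negb_or => /and3P[-> ->].
- apply: (IH (y :: rcons s z)).
    by move: le_cn; rewrite -size_c /=.
  rewrite /dicycle /= size_rcons rcons_path last_rcons pyz azy /=.
  by rewrite yN Us.
Qed.

Hypothesis earlier_card : forall x, #|earlier_nbrs x| <= 3.
Hypothesis no_digon : forall x y, arc G x y -> ~~ arc G y x.

Lemma backward_once_orders :
  exists r : 'I_3 -> V -> nat, forall u v, arc G u v -> backward_once r u v.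
Proof.
suff: forall m, exists r : 'I_3 -> V -> nat, forall u v,
    pos u < m -> pos v < m -> arc G u v -> backward_once r u v.
  case/(_ (\max_x (pos x).+1)) => r hr; exists r => u v.
  by apply: hr; apply: (leq_bigmax (F := fun x => (pos x).+1)).
elim=> [|m [r hr]]; first by exists (fun _ _ => 0).
(* The values of [pos] may have gaps; if none equals [m], the same orders still serve. *)
have [/existsP[x /eqP posx]|/existsPn nom] := boolP [exists x, pos x == m];
  last first.
  exists r => u v; rewrite !ltnS leq_eqVlt (negbTE (nom u)) /= => um.
  by rewrite leq_eqVlt (negbTE (nom v)) => vm; apply: hr.
pose A := [set y | (pos y < m) && arc G y x].
pose B := [set y | (pos y < m) && arc G x y].
have nbrE : A :|: B = earlier_nbrs x.
  by apply/setP => y; rewrite !inE posx /under_adj -andb_orr orbC.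
(* Without digons, [#|A| + #|B|] is the number of earlier neighbours. *)
have disjAB : A :&: B = set0.
  apply/setP => y; rewrite !inE; apply/negP => /andP[/andP[_ ayx] /andP[_]].
  by rewrite (negbTE (no_digon ayx)).
have [||t [tA tB]] := @insertable_le3 V r A B.
- by rewrite -cardsUI disjAB cards0 addn0 nbrE.
- move=> y z yA zB.
  have neq_yz : y != z.
    apply/eqP => E; have : y \in A :&: B by rewrite inE yA E.
    by rewrite disjAB inE.
  (* If the arc goes from [y] to [z], any order other than its backward one puts [y] before [z]; if
     it goes from [z] to [y], its backward order does. *)
  have /orP[ayz|azy] : under_adj G y z.
    apply: (earlier_clique (x := x)) => //.
      by rewrite -nbrE inE yA.
    by rewrite -nbrE inE zB orbT.
  + move: yA zB; rewrite !inE => /andP[ym _] /andP[zm _].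
    have [k hk] := hr _ _ ym zm ayz.
    by exists (ordS k); rewrite (hk _).1; case: k {hk} => [[|[|[|]]]].
  + move: yA zB; rewrite !inE => /andP[ym _] /andP[zm _].
    have [k hk] := hr _ _ zm ym azy.
    by exists k; rewrite (hk _).2.
have old u : pos u < m.+1 -> u != x -> pos u < m.
  rewrite ltnS leq_eqVlt => /orP[/eqP E|//]; case/eqP.
  by apply: pos_inj; rewrite E posx.
exists (insert_at r t x) => u v um vm auv.
have [Eu|ux] := eqVneq u x; have [Ev|vx] := eqVneq v x.
- by move: auv; rewrite Eu Ev arc_irrefl.
- have vB : v \in B by rewrite inE old //= -Eu.
  have [k hk] := tB _ vB; exists k => l.
  by rewrite Eu insert_at_lt_new // insert_at_gt_new // hk.
- have uA : u \in A by rewrite inE old //= -Ev.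
  have [k hk] := tA _ uA; exists k => l.
  by rewrite Ev insert_at_lt_new // insert_at_gt_new // hk negbK.
- have [k hk] := hr _ _ (old _ um ux) (old _ vm vx) auv.
  by exists k => l; rewrite !insert_at_lt.
Qed.

End PerfectElimination.

(** * From 3-trees to the equality *)

Lemma ktree_elimination (k : nat) (V : finType) (G : digraph V) :
  is_ktree k (underlying G) ->
  exists pos : V -> nat, [/\ injective pos,
    forall x, clique (underlying G) (earlier_nbrs G pos x) &
    forall x, #|earlier_nbrs G pos x| <= k].
Proof.
case=> _ [v [[w vK wK] hv]]; exists (fun x => w x).
have back x : earlier_nbrs G (fun x => w x) x =
    back_nbrs (underlying G) v (w x).
  apply/setP => y; rewrite inE; apply/idP/imsetP.
    move=> /andP[lt_yx axy]; exists (w y); rewrite ?wK //.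
    by rewrite inE (ltnW lt_yx) !wK.
  case=> j; rewrite inE wK /= => /andP[le_j ax] ->; rewrite vK ax andbT.
  (* [back_nbrs] allows [j] to be the position of [x] itself, which irreflexivity rules out. *)
  rewrite ltn_neqAle le_j andbT; apply: contraTneq ax => /val_inj ->.
  by rewrite wK under_adj_irrefl.
split=> [x y /val_inj/(can_inj wK) //|x|x]; rewrite back.
  by have [] := hv (w x).
by have [_ ->] := hv (w x); rewrite geq_minl.
Qed.

Theorem theorem2 (V : finType) (G : digraph V)
    (hG : exists c : seq V, dicycle G c)
    (h3 : is_ktree 3 (underlying G)) :
  nu G = girth hG.
Proof.
have [pos [pos_inj cl card3]] := ktree_elimination h3.
rewrite /girth; case: ex_minnP => n /existsP[c hc] nmin.
have minc c' : dicycle G c' -> n <= size c'.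
  by move=> hc'; apply: nmin; apply/existsP; exists (in_tuple c').
apply/eqP; rewrite eqn_leq -{1}(size_tuple c) nu_le_dicycle //=.
have [/existsP[x /existsP[y /andP[axy ayx]]]|nodigon] :=
    boolP [exists x, exists y, arc G x y && arc G y x].
  apply: leq_trans (nu_ge2 hG); apply: (minc [:: x; y]).
  rewrite /dicycle /= axy ayx inE /= andbT; apply: contraTneq axy => ->.
  by rewrite arc_irrefl.
(* Without digons, the girth is at most 3 and three orders give a packing of size 3. *)
have [c' hc' le3] := short_dicycle pos_inj cl hc.
apply: leq_trans (minc _ hc') (leq_trans le3 _).
have [x y axy|r hr] := backward_once_orders pos_inj cl card3.
  move: nodigon => /existsPn/(_ x)/existsPn/(_ y).
  by rewrite axy.
exact: nu_ge_orders hr.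
Qed.
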